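(* Let $M$ be a vector space over a field $\mathbf k$ and $A_M\in\mathrm{End}_{\mathbf k}(M)$. Then abelian extensions of an averaging algebra $(R,A)$ by $(M,A_M)$ are classified by the second cohomology group $\mathrm H^2_{\mathrm{AvA}}(R,M)$ of $(R,A)$ with coefficients in the bimodule $(M,A_M)$.
   Context: All vector spaces and algebras are over a field $\mathbf k$. An averaging algebra $(R,A)$ is an associative algebra $R$ with a linear map $A:R\to R$ satisfying $A(x)A(y)=A(xA(y))=A(A(x)y)$ for all $x,y\in R$; morphisms are algebra homomorphisms commuting with the operators. A bimodule over $(R,A)$ is an $R$-bimodule $M$ with a linear map $A_M:M\to M$ such that $A(r)A_M(m)=A_M(A(r)m)=A_M(rA_M(m))$ and $A_M(m)A(r)=A_M(A_M(m)r)=A_M(mA(r))$ for all $r\in R$, $m\in M$. An abelian extension of $(R,A)$ by $(M,A_M)$ is a short exact sequence of homomorphisms of averaging algebras $0\to(M,A_M)\xrightarrow{i}(\hat R,\hat A)\xrightarrow{p}(R,A)\to0$ such that $uv=0$ for all $u,v\in M$. A section is a linear map $s:R\to\hat R$ with $p\circ s=\mathrm{id}_R$. Given an abelian extension with a section $s$, the actions $rm:=s(r)m$, $mr:=ms(r)$ together with $A_M$ make $M$ a bimodule over $(R,A)$. Two abelian extensions $(\hat R_1,\hat A_1)$, $(\hat R_2,\hat A_2)$ of $(R,A)$ by $(M,A_M)$ are isomorphic if there is an isomorphism of averaging algebras $\zeta:\hat R_1\to\hat R_2$ inducing the identity on $M$ and on $R$. Cohomology with coefficients in a bimodule $(M,A_M)$.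 Let $C^n_{\mathrm{Alg}}(R,M)=\mathrm{Hom}(R^{\otimes n},M)$ with Hochschild differential $\delta f(x_1\otimes\cdots\otimes x_{n+1})=x_1f(x_2\otimes\cdots\otimes x_{n+1})+\sum_{i=1}^n(-1)^if(\cdots\otimes x_ix_{i+1}\otimes\cdots)+(-1)^{n+1}f(x_1\otimes\cdots\otimes x_n)x_{n+1}$ (for $n=0$, $\delta(m)(r)=rm-mr$). Let $C^0_{\mathrm{AvO}}(R,M)=\mathrm{Hom}(\mathbf k,M)=M$, $C^1_{\mathrm{AvO}}(R,M)=\mathrm{Hom}(R,M)$, and $C^n_{\mathrm{AvO}}(R,M)=C^n_r\oplus C^n_l$ with $C^n_r=C^n_l=\mathrm{Hom}(R^{\otimes n},M)$ for $n\ge2$. Its differential $\partial$ is: in degree $0$, $\partial_0(m)(r)=A_M(mr)-A_M(rm)-mA(r)+A(r)m$; in degree $1$, $f\mapsto(\partial_rf,\partial_lf)$; in degree $n\ge2$, $(f,g)\mapsto(\partial_rf,\partial_lg)$; where for $f,g\in\mathrm{Hom}(R^{\otimes n},M)$ $\partial_rf(x_1\otimes\cdots\otimes x_{n+1})=A(x_1)f(x_2\otimes\cdots\otimes x_{n+1})-A_M(x_1f(x_2\otimes\cdots\otimes x_{n+1}))+\sum_{i=1}^n(-1)^if(\cdots\otimes x_iA(x_{i+1})\otimes\cdots)+(-1)^{n+1}f(x_1\otimes\cdots\otimes x_n)A(x_{n+1})$, $\partial_lg(x_1\otimes\cdots\otimes x_{n+1})=A(x_1)g(x_2\otimes\cdots\otimes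 x_{n+1})+\sum_{i=1}^n(-1)^ig(\cdots\otimes A(x_i)x_{i+1}\otimes\cdots)+(-1)^{n+1}g(x_1\otimes\cdots\otimes x_n)A(x_{n+1})+(-1)^nA_M(g(x_1\otimes\cdots\otimes x_n)x_{n+1})$. Let $\Phi^n:C^n_{\mathrm{Alg}}(R,M)\to C^n_{\mathrm{AvO}}(R,M)$ be $\Phi^0=\mathrm{id}$, $\Phi^1(f)=f\circ A-A_M\circ f$, and for $n\ge2$, $\Phi^n(f)=(\Phi^n_r(f),\Phi^n_l(f))$ with $\Phi^n_r(f)=f\circ A^{\otimes n}-A_M\circ f\circ(\mathrm{id}\otimes A^{\otimes n-1})$, $\Phi^n_l(f)=f\circ A^{\otimes n}-A_M\circ f\circ(A^{\otimes n-1}\otimes\mathrm{id})$. The complex $C^\bullet_{\mathrm{AvA}}(R,M)$ has $C^n_{\mathrm{AvA}}(R,M)=C^n_{\mathrm{Alg}}(R,M)\oplus C^{n-1}_{\mathrm{AvO}}(R,M)$ (with $C^{-1}_{\mathrm{AvO}}=0$) and differential $d(f,g)=(\delta f,\ (-1)^n\Phi^n(f)+\partial g)$ for $(f,g)$ in degree $n$. Its cohomology is $\mathrm H^\bullet_{\mathrm{AvA}}(R,M)$. *)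

(* Defs.v *)
From HB Require Import structures.
From mathcomp Require Import all_boot all_algebra.
From mathcomp Require Import boolp functions.

Set Implicit Arguments.
Unset Strict Implicit.
Unset Printing Implicit Defensive.

Import GRing.Theory.
Local Open Scope ring_scope.

(* Associative algebras are not assumed unital: MathComp's algebra structures
   all carry a unit, while the extensions below have an ideal of square zero as
   kernel, so the product is given here as a bilinear map on a vector space. *)
Record avgAlg (k : fieldType) := AvgAlg {
  avg_car :> lmodType k;
  avg_mul : {bilinear avg_car -> avg_car -> avg_car};
  avg_op : {linear avg_car -> avg_car};
  avg_mulA : forall x y z, avg_mul x (avg_mul y z) = avg_mul (avg_mul x y) z;
  avg_opr : forall x y,
    avg_mul (avg_op x) (avg_op y) = avg_op (avg_mul x (avg_op y));
  avg_opl : forall x y,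
    avg_mul (avg_op x) (avg_op y) = avg_op (avg_mul (avg_op x) y) }.

Arguments avg_mul {k a}.
Arguments avg_op {k a}.

Definition is_avg_hom (k : fieldType) (R S : avgAlg k) (f : {linear R -> S}) :=
  (forall x y, f (avg_mul x y) = avg_mul (f x) (f y)) /\
  (forall x, f (avg_op x) = avg_op (f x)).

Record avgBimod (k : fieldType) (R : avgAlg k) (M : lmodType k)
    (AM : {linear M -> M}) := AvgBimod {
  lact : {bilinear R -> M -> M};
  ract : {bilinear M -> R -> M};
  lactA : forall r s m, lact (avg_mul r s) m = lact r (lact s m);
  lractA : forall r m s, ract (lact r m) s = lact r (ract m s);
  ractA : forall m r s, ract m (avg_mul r s) = ract (ract m r) s;
  lact_opl : forall r m, lact (avg_op r) (AM m) = AM (lact (avg_op r) m);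
  lact_opr : forall r m, lact (avg_op r) (AM m) = AM (lact r (AM m));
  ract_opl : forall m r, ract (AM m) (avg_op r) = AM (ract (AM m) r);
  ract_opr : forall m r, ract (AM m) (avg_op r) = AM (ract m (avg_op r)) }.

Section ZeroProduct.
Variables (k : fieldType) (M : lmodType k).

Definition zero_mul (x y : M) : M := 0.

Let zero_mul_bilinear : bilinear_for *:%R *:%R zero_mul.
Proof. by split=> z a x y /=; rewrite /zero_mul scaler0 addr0. Qed.

HB.instance Definition _ :=
  bilinear_isBilinear.Build k M M M *:%R *:%R zero_mul zero_mul_bilinear.

Variable AM : {linear M -> M}.

Let zero_op x y : zero_mul (AM x) (AM y) = AM 0.
Proof. by rewrite linear0. Qed.

Definition zero_avgAlg : avgAlg k :=
  @AvgAlg k M zero_mul AM (fun _ _ _ => erefl) zero_op zero_op.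

End ZeroProduct.

(* The condition uv = 0 for u, v in M is the multiplicativity of [ext_i], as M
   carries the zero product. *)
Record abext (k : fieldType) (R : avgAlg k) (M : lmodType k)
    (AM : {linear M -> M}) := AbExt {
  ext_alg :> avgAlg k;
  ext_i : {linear zero_avgAlg AM -> ext_alg};
  ext_p : {linear ext_alg -> R};
  ext_i_hom : is_avg_hom ext_i;
  ext_p_hom : is_avg_hom ext_p;
  ext_i_inj : injective ext_i;
  ext_exact : forall x, ext_p x = 0 <-> exists m, ext_i m = x;
  ext_p_surj : forall r, exists x, ext_p x = r }.

Section Extensions.
Variables (k : fieldType) (R : avgAlg k) (M : lmodType k) (AM : {linear M -> M}).
Implicit Types (E : abext R AM) (B : avgBimod R AM).

Definition is_section E (s : {linear R -> E}) := forall r, ext_p E (s r) = r.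

Definition induces E B := exists2 s : {linear R -> E}, is_section s &
  forall r m, ext_i E (lact B r m) = avg_mul (s r) (ext_i E m) /\
              ext_i E (ract B m r) = avg_mul (ext_i E m) (s r).

Definition abext_over B := {E : abext R AM | induces E B}.

Definition ext_iso E1 E2 := exists zeta : {linear E1 -> E2},
  [/\ is_avg_hom zeta, bijective zeta,
      forall m, zeta (ext_i E1 m) = ext_i E2 m
    & forall x, ext_p E2 (zeta x) = ext_p E1 x].

End Extensions.

Section Multilinear.
Variables (k : fieldType) (R M : lmodType k) (n : nat).

Definition ffun_upd (x : {ffun 'I_n -> R}) (i : 'I_n) (u : R) :
    {ffun 'I_n -> R} :=
  [ffun j => if j == i then u else x j].

Definition multilinear (f : {ffun 'I_n -> R} -> M) :=
  forall x i, linear (fun u => f (ffun_upd x i u)).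

Definition mlin_pred : {pred ({ffun 'I_n -> R} -> M)} :=
  fun f => `[< multilinear f >].

Lemma mlin_pred_submod : submod_closed mlin_pred.
Proof.
split=> [|a f g /asboolP fl /asboolP gl]; apply/asboolP => x i b u v.
  by rewrite scaler0 addr0.
rewrite -![(a *: f + g) _]/(a *: f _ + g _) fl gl !scalerDr !scalerA.
by rewrite [a * b]mulrC addrACA.
Qed.

HB.instance Definition _ := GRing.isSubmodClosed.Build k
  ({ffun 'I_n -> R} -> M) mlin_pred mlin_pred_submod.

(* Hom(R^{(x)n}, M), through the universal property of the tensor power; for
   n = 0 these are the maps from a point, that is the elements of M. *)
Record mlin := MLin {
  mlin_fun :> {ffun 'I_n -> R} -> M;
  mlin_funP : mlin_fun \in mlin_pred }.

HB.instance Definition _ := [isSub for mlin_fun].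
HB.instance Definition _ := [Choice of mlin by <:].
HB.instance Definition _ := [SubChoice_isSubLmodule of mlin by <:].

Definition mk_mlin (f : {ffun 'I_n -> R} -> M) (fl : multilinear f) : mlin :=
  MLin (asboolT fl).

Lemma mlinP (f : mlin) : multilinear f.
Proof. by apply/asboolP/mlin_funP. Qed.

End Multilinear.

Section Faces.
Variables (k : fieldType) (R : lmodType k) (n : nat).
Implicit Types (x : {ffun 'I_n.+1 -> R}).

Definition ffun_tail x : {ffun 'I_n -> R} := [ffun i => x (lift ord0 i)].

Definition ffun_init x : {ffun 'I_n -> R} := [ffun i => x (lift ord_max i)].

(* (x_0, ..., op x_j x_{j+1}, ..., x_n), with j counted from 0; the index
   [lift ord_max i] has value i, and [lift ord0 i] has value i + 1. *)
Definition ffun_merge (op : R -> R -> R) (j : 'I_n) x : {ffun 'I_n -> R} :=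
  [ffun i : 'I_n => if (i < j)%N then x (lift ord_max i)
                       else if i == j
                            then op (x (lift ord_max i)) (x (lift ord0 i))
                       else x (lift ord0 i)].

Lemma ffun_updE m (y : {ffun 'I_m -> R}) i u j :
  ffun_upd y i u j = if j == i then u else y j.
Proof. by rewrite ffunE. Qed.

Lemma ffun_updii m (y : {ffun 'I_m -> R}) i u : ffun_upd y i u i = u.
Proof. by rewrite ffunE eqxx. Qed.

Lemma tail_upd0 x u : ffun_tail (ffun_upd x ord0 u) = ffun_tail x.
Proof. by apply/ffunP => i; rewrite !ffunE eq_sym (negPf (neq_lift _ _)). Qed.

Lemma tail_updS x i u :
  ffun_tail (ffun_upd x (lift ord0 i) u) = ffun_upd (ffun_tail x) i u.
Proof. by apply/ffunP => j; rewrite !ffunE (inj_eq lift_inj). Qed.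

Lemma init_upd_max x u : ffun_init (ffun_upd x ord_max u) = ffun_init x.
Proof. by apply/ffunP => i; rewrite !ffunE eq_sym (negPf (neq_lift _ _)). Qed.

Lemma init_upd x i u :
  ffun_init (ffun_upd x (lift ord_max i) u) = ffun_upd (ffun_init x) i u.
Proof. by apply/ffunP => j; rewrite !ffunE (inj_eq lift_inj). Qed.

Variables (M : lmodType k).

Lemma multilinear_tail (L : R -> M -> M) (f : {ffun 'I_n -> R} -> M) :
  bilinear_for *:%R *:%R L -> multilinear f ->
  multilinear (fun x => L (x ord0) (f (ffun_tail x))).
Proof.
move=> [Ll Lr] fl x i a u v; case: (unliftP ord0 i) => [j|] ->; last first.
  by rewrite !tail_upd0 !ffun_updii Ll.
by rewrite !tail_updS !ffun_updE (negPf (neq_lift _ _)) fl Lr.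
Qed.

Lemma multilinear_init (L : M -> R -> M) (f : {ffun 'I_n -> R} -> M) :
  bilinear_for *:%R *:%R L -> multilinear f ->
  multilinear (fun x => L (f (ffun_init x)) (x ord_max)).
Proof.
move=> [Ll Lr] fl x i a u v; case: (unliftP ord_max i) => [j|] ->; last first.
  by rewrite !init_upd_max !ffun_updii Lr.
by rewrite !init_upd !ffun_updE (negPf (neq_lift _ _)) fl Ll.
Qed.

Lemma multilinear_merge (op : R -> R -> R) j (f : {ffun 'I_n -> R} -> M) :
  bilinear_for *:%R *:%R op -> multilinear f ->
  multilinear (fun x => f (ffun_merge op j x)).
Proof.
move=> [opl opr] fl x i.
have E0 (t : 'I_n) : (lift ord0 t == i) = (t.+1 == i :> nat) by [].
have E1 (t : 'I_n) : (lift ord_max t == i) = (t == i :> nat).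
  by rewrite -val_eqE /= /bump leqNgt ltn_ord.
have [lt_ij|lt_ji|eq_ij] := ltngtP i j.
- have lt_in : (i < n)%N := ltn_trans lt_ij (ltn_ord j).
  have E u : ffun_merge op j (ffun_upd x i u) =
             ffun_upd (ffun_merge op j x) (Ordinal lt_in) u.
    apply/ffunP => t; rewrite !ffunE E0 E1 -!val_eqE /=.
    case: (ltngtP t j) => // [lt_jt|/val_inj->].
    + have lt_it := ltn_trans lt_ij lt_jt.
      by rewrite (gtn_eqF lt_it) (gtn_eqF (leqW lt_it)).
    + by rewrite (gtn_eqF lt_ij) (gtn_eqF (leqW lt_ij)).
  by move=> a u v; rewrite !E fl.
- have [eq_ij|ne_ij] := eqVneq (i : nat) j.+1.
    have E u : ffun_merge op j (ffun_upd x i u) =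
      ffun_upd (ffun_merge op j x) j (op (x (lift ord_max j)) u).
      apply/ffunP => t; rewrite !ffunE E0 E1 eq_ij eqSS -!val_eqE /=.
      case: (ltngtP t j) => // [lt_tj|/val_inj->]; last by rewrite ltn_eqF.
      by rewrite ltn_eqF// ltnW.
    by move=> a u v; rewrite !E opr fl.
  have lt_ji' : (j.+1 < i)%N by rewrite ltn_neqAle eq_sym ne_ij.
  have lt_in : (i.-1 < n)%N by case: (i : nat) (ltn_ord i) lt_ji.
  have iK : i.-1.+1 = i by case: (i : nat) lt_ji.
  have E u : ffun_merge op j (ffun_upd x i u) =
             ffun_upd (ffun_merge op j x) (Ordinal lt_in) u.
    apply/ffunP => t; rewrite !ffunE E0 E1 -!val_eqE /=.
    have -> : (t == i.-1 :> nat) = (t.+1 == i :> nat) by rewrite -[in RHS]iK.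
    case: (ltngtP t j) => // [lt_tj|/val_inj->].
    + have lt_ti : (t.+1 < i)%N by apply: leq_ltn_trans lt_ji'; apply: leqW.
      by rewrite (ltn_eqF lt_ti) (ltn_eqF (ltnW lt_ti)).
    + by rewrite (ltn_eqF lt_ji) (ltn_eqF lt_ji').
  by move=> a u v; rewrite !E fl.
- have E u : ffun_merge op j (ffun_upd x i u) =
    ffun_upd (ffun_merge op j x) j (op u (x (lift ord0 j))).
    apply/ffunP => t; rewrite !ffunE E0 E1 -!val_eqE /= eq_ij.
    case: (ltngtP t j) => // [lt_jt|/val_inj->]; last by rewrite gtn_eqF.
    by rewrite gtn_eqF// ltnW.
  by move=> a u v; rewrite !E opl fl.
Qed.

End Faces.

Section LinearClosure.
Variables (k : fieldType) (U V W : lmodType k).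
Implicit Types F G : U -> V.

Lemma linear_addf F G : linear F -> linear G -> linear (fun u => F u + G u).
Proof. by move=> Fl Gl a u v; rewrite Fl Gl scalerDr addrACA. Qed.

Lemma linear_scalef c F : linear F -> linear (fun u => c *: F u).
Proof. by move=> Fl a u v; rewrite Fl scalerDr !scalerA mulrC. Qed.

Lemma linear_oppf F : linear F -> linear (fun u => - F u).
Proof. by move=> Fl a u v; rewrite Fl opprD scalerN. Qed.

Lemma linear_sumf n (F : 'I_n -> U -> V) :
  (forall i, linear (F i)) -> linear (fun u => \sum_i F i u).
Proof.
move=> Fl a u v; rewrite scaler_sumr -big_split.
by apply: eq_bigr => i _; rewrite Fl.
Qed.

Lemma linear_compf (g : V -> W) F : linear g -> linear F ->
  linear (fun u => g (F u)).
Proof. by move=> gl Fl a u v; rewrite Fl gl. Qed.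

Lemma linear_eval n (x : {ffun 'I_n -> U}) :
  linear (fun f : mlin U V n => f x).
Proof. by []. Qed.

End LinearClosure.

Section OpOn.
Variables (k : fieldType) (R M : lmodType k) (n : nat) (A : {linear R -> R}).

(* [A] applied to the entries whose position satisfies [P]. *)
Definition ffun_op (P : pred nat) (x : {ffun 'I_n -> R}) : {ffun 'I_n -> R} :=
  [ffun i : 'I_n => if P i then A (x i) else x i].

Lemma multilinear_op P (f : {ffun 'I_n -> R} -> M) :
  multilinear f -> multilinear (fun x => f (ffun_op P x)).
Proof.
move=> fl x i.
have E u : ffun_op P (ffun_upd x i u) =
           ffun_upd (ffun_op P x) i (if P i then A u else u).
  by apply/ffunP => j; rewrite !ffunE; case: eqP => // ->.
by move=> a u v; rewrite !E; case: (P i); rewrite ?linearP fl.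
Qed.

End OpOn.

Section Complex.
Variables (k : fieldType) (R : avgAlg k) (M : lmodType k) (AM : {linear M -> M}).
Variable B : avgBimod R AM.

Local Notation A := (@avg_op k R).
Local Notation C n := (mlin R M n).
Local Notation "x ** y" := (@avg_mul k R x y) (at level 40).
Local Notation "x *l m" := (lact B x m) (at level 40).
Local Notation "m *r x" := (ract B m x) (at level 40).

Definition delta_fun n (f : C n) (x : {ffun 'I_n.+1 -> R}) : M :=
  x ord0 *l f (ffun_tail x)
  + \sum_(i < n) (-1) ^+ i.+1 *: f (ffun_merge (fun a b => a ** b) i x)
  + (-1) ^+ n.+1 *: (f (ffun_init x) *r x ord_max).

Definition dr_fun n (f : C n) (x : {ffun 'I_n.+1 -> R}) : M :=
  (A (x ord0) *l f (ffun_tail x) - AM (x ord0 *l f (ffun_tail x)))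
  + \sum_(i < n) (-1) ^+ i.+1 *: f (ffun_merge (fun a b => a ** A b) i x)
  + (-1) ^+ n.+1 *: (f (ffun_init x) *r A (x ord_max)).

Definition dl_fun n (g : C n) (x : {ffun 'I_n.+1 -> R}) : M :=
  A (x ord0) *l g (ffun_tail x)
  + \sum_(i < n) (-1) ^+ i.+1 *: g (ffun_merge (fun a b => A a ** b) i x)
  + (-1) ^+ n.+1 *: (g (ffun_init x) *r A (x ord_max))
  + (-1) ^+ n *: AM (g (ffun_init x) *r x ord_max).

Definition d0_fun (m : C 0) (x : {ffun 'I_1 -> R}) : M :=
  let r := x ord0 in let v := m (ffun_tail x) in
  AM (v *r r) - AM (r *l v) - v *r A r + A r *l v.

Definition Phir_fun n (f : C n) (x : {ffun 'I_n -> R}) : M :=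
  f (ffun_op A predT x) - AM (f (ffun_op A (fun i => i != 0%N) x)).

Definition Phil_fun n (f : C n) (x : {ffun 'I_n -> R}) : M :=
  f (ffun_op A predT x) - AM (f (ffun_op A (fun i => i != n.-1) x)).

Let AMl : linear AM. Proof. exact: linearP. Qed.
Let mul_b : bilinear_for *:%R *:%R (fun a b : R => a ** b).
Proof. by split=> z a u v /=; rewrite (linearPl, linearPr). Qed.
Let mulr_b : bilinear_for *:%R *:%R (fun a b : R => a ** A b).
Proof. by split=> z a u v /=; rewrite ?(linearP avg_op) (linearPl, linearPr). Qed.
Let mull_b : bilinear_for *:%R *:%R (fun a b : R => A a ** b).
Proof. by split=> z a u v /=; rewrite ?(linearP avg_op) (linearPl, linearPr). Qed.
Let lact_b : bilinear_for *:%R *:%R (fun r m => r *l m).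
Proof. by split=> z a u v /=; rewrite (linearPl, linearPr). Qed.
Let lactA_b : bilinear_for *:%R *:%R (fun r m => A r *l m).
Proof. by split=> z a u v /=; rewrite ?(linearP avg_op) (linearPl, linearPr). Qed.
Let ract_b : bilinear_for *:%R *:%R (fun m r => m *r r).
Proof. by split=> z a u v /=; rewrite (linearPl, linearPr). Qed.
Let ractA_b : bilinear_for *:%R *:%R (fun m r => m *r A r).
Proof. by split=> z a u v /=; rewrite ?(linearP avg_op) (linearPl, linearPr). Qed.

Let tailP n (L : R -> M -> M) (f : C n) : bilinear_for *:%R *:%R L ->
  multilinear (fun x => L (x ord0) (f (ffun_tail x))).
Proof. by move=> Lb; apply: multilinear_tail Lb (mlinP f). Qed.

Let initP n (L : M -> R -> M) (f : C n) : bilinear_for *:%R *:%R L ->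
  multilinear (fun x => L (f (ffun_init x)) (x ord_max)).
Proof. by move=> Lb; apply: multilinear_init Lb (mlinP f). Qed.

Let mergeP n (op : R -> R -> R) (f : C n) : bilinear_for *:%R *:%R op ->
  multilinear (fun x =>
    \sum_(i < n) (-1) ^+ i.+1 *: f (ffun_merge op i x)).
Proof.
move=> opb x i; apply: linear_sumf => j; apply: linear_scalef.
exact: multilinear_merge opb (mlinP f) x i.
Qed.

Lemma delta_multilinear n (f : C n) : multilinear (delta_fun f).
Proof.
move=> x i; apply: linear_addf; last first.
  by apply: linear_scalef; apply: (initP f ract_b).
by apply: linear_addf; [apply: (tailP f lact_b) | apply: mergeP mul_b _ _].
Qed.

Lemma dr_multilinear n (f : C n) : multilinear (dr_fun f).
Proof.
move=> x i; apply: linear_addf; last first.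
  by apply: linear_scalef; apply: (initP f ractA_b).
apply: linear_addf; last exact: mergeP mulr_b _ _.
apply: linear_addf; first exact: (tailP f lactA_b).
by apply: linear_oppf; apply: linear_compf AMl _; apply: (tailP f lact_b).
Qed.

Lemma dl_multilinear n (f : C n) : multilinear (dl_fun f).
Proof.
move=> x i; apply: linear_addf; last first.
  apply: linear_scalef; apply: linear_compf AMl _.
  exact: (initP f ract_b).
apply: linear_addf; last first.
  by apply: linear_scalef; apply: (initP f ractA_b).
by apply: linear_addf; [apply: (tailP f lactA_b) | apply: mergeP mull_b _ _].
Qed.

Let d0_b : bilinear_for *:%R *:%R (fun r v =>
  AM (v *r r) - AM (r *l v) - v *r A r + A r *l v).
Proof.
split=> z.
  apply: linear_addf; last exact: lactA_b.1.
  apply: linear_addf; last by apply: linear_oppf; apply: ractA_b.2.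
  apply: linear_addf; first by apply: linear_compf AMl _; apply: ract_b.2.
  by apply: linear_oppf; apply: linear_compf AMl _; apply: lact_b.1.
apply: linear_addf; last exact: lactA_b.2.
apply: linear_addf; last by apply: linear_oppf; apply: ractA_b.1.
apply: linear_addf; first by apply: linear_compf AMl _; apply: ract_b.1.
by apply: linear_oppf; apply: linear_compf AMl _; apply: lact_b.2.
Qed.

Lemma d0_multilinear (m : C 0) : multilinear (d0_fun m).
Proof. exact: (tailP m d0_b). Qed.

Lemma Phir_multilinear n (f : C n) : multilinear (Phir_fun f).
Proof.
move=> x i; apply: linear_addf; first exact: (multilinear_op _ _ (mlinP f)).
apply: linear_oppf; apply: linear_compf AMl _.
exact: (multilinear_op _ _ (mlinP f)).
Qed.

Lemma Phil_multilinear n (f : C n) : multilinear (Phil_fun f).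
Proof.
move=> x i; apply: linear_addf; first exact: (multilinear_op _ _ (mlinP f)).
apply: linear_oppf; apply: linear_compf AMl _.
exact: (multilinear_op _ _ (mlinP f)).
Qed.

Definition delta n (f : C n) : C n.+1 := mk_mlin (delta_multilinear f).

Lemma delta_linear n : linear (@delta n).
Proof.
move=> a f g; apply: val_inj; apply: funext => x.
suff: linear (fun f : C n => delta_fun f x) by apply.
apply: linear_addf.
  apply: linear_addf; first exact: linear_compf (lact_b.2 _) (linear_eval _).
  by apply: linear_sumf => i; apply: linear_scalef; apply: linear_eval.
apply: linear_scalef; exact: linear_compf (ract_b.1 _) (linear_eval _).
Qed.

HB.instance Definition _ n :=
  GRing.isLinear.Build k (C n) (C n.+1) *:%R (@delta n) (@delta_linear n).

Definition dr n (f : C n) : C n.+1 := mk_mlin (dr_multilinear f).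

Lemma dr_linear n : linear (@dr n).
Proof.
move=> a f g; apply: val_inj; apply: funext => x.
suff: linear (fun f : C n => dr_fun f x) by apply.
apply: linear_addf; last first.
  by apply: linear_scalef; apply: linear_compf (ractA_b.1 _) (linear_eval _).
apply: linear_addf.
  apply: linear_addf; first exact: linear_compf (lactA_b.2 _) (linear_eval _).
  apply: linear_oppf; apply: linear_compf AMl _.
  exact: linear_compf (lact_b.2 _) (linear_eval _).
by apply: linear_sumf => i; apply: linear_scalef; apply: linear_eval.
Qed.

HB.instance Definition _ n :=
  GRing.isLinear.Build k (C n) (C n.+1) *:%R (@dr n) (@dr_linear n).

Definition dl n (f : C n) : C n.+1 := mk_mlin (dl_multilinear f).

Lemma dl_linear n : linear (@dl n).
Proof.
move=> a f g; apply: val_inj; apply: funext => x.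
suff: linear (fun f : C n => dl_fun f x) by apply.
apply: linear_addf; last first.
  apply: linear_scalef; apply: linear_compf AMl _.
  exact: linear_compf (ract_b.1 _) (linear_eval _).
apply: linear_addf; last first.
  by apply: linear_scalef; apply: linear_compf (ractA_b.1 _) (linear_eval _).
apply: linear_addf; first exact: linear_compf (lactA_b.2 _) (linear_eval _).
by apply: linear_sumf => i; apply: linear_scalef; apply: linear_eval.
Qed.

HB.instance Definition _ n :=
  GRing.isLinear.Build k (C n) (C n.+1) *:%R (@dl n) (@dl_linear n).

Definition d0 (m : C 0) : C 1 := mk_mlin (d0_multilinear m).

Lemma d0_linear : linear d0.
Proof.
move=> a f g; apply: val_inj; apply: funext => x.
suff: linear (fun f : C 0 => d0_fun f x) by apply.
exact: linear_compf (d0_b.2 _) (linear_eval _).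
Qed.

HB.instance Definition _ :=
  GRing.isLinear.Build k (C 0) (C 1) *:%R d0 d0_linear.

Definition Phir n (f : C n) : C n := mk_mlin (Phir_multilinear f).

Lemma Phir_linear n : linear (@Phir n).
Proof.
move=> a f g; apply: val_inj; apply: funext => x.
suff: linear (fun f : C n => Phir_fun f x) by apply.
apply: linear_addf; first exact: linear_eval.
by apply: linear_oppf; apply: linear_compf AMl (linear_eval _).
Qed.

HB.instance Definition _ n :=
  GRing.isLinear.Build k (C n) (C n) *:%R (@Phir n) (@Phir_linear n).

Definition Phil n (f : C n) : C n := mk_mlin (Phil_multilinear f).

Lemma Phil_linear n : linear (@Phil n).
Proof.
move=> a f g; apply: val_inj; apply: funext => x.
suff: linear (fun f : C n => Phil_fun f x) by apply.
apply: linear_addf; first exact: linear_eval.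
by apply: linear_oppf; apply: linear_compf AMl (linear_eval _).
Qed.

HB.instance Definition _ n :=
  GRing.isLinear.Build k (C n) (C n) *:%R (@Phil n) (@Phil_linear n).

Definition CAvO n : lmodType k :=
  match n with
  | 0 => C 0
  | 1 => C 1
  | m.+2 => (C m.+2 * C m.+2)%type
  end.

Definition dAvO n : CAvO n -> CAvO n.+1 :=
  match n with
  | 0 => d0
  | 1 => fun f => (dr f, dl f)
  | m.+2 => fun fg => (dr fg.1, dl fg.2)
  end.

Lemma dAvO_linear n : linear (@dAvO n).
Proof.
case: n => [|[|n]] a f g; first exact: linearP.
  by rewrite /= !linearP.
by rewrite /= !linearP.
Qed.

HB.instance Definition _ n :=
  GRing.isLinear.Build k (CAvO n) (CAvO n.+1) *:%R (@dAvO n) (@dAvO_linear n).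

(* In degree 1, [Phir f] is f o A - A_M o f, since the tensor power of A in its
   second term is empty. *)
Definition Phi n : C n -> CAvO n :=
  match n with
  | 0 => fun f => f
  | 1 => fun f => Phir f
  | m.+2 => fun f => (Phir f, Phil f)
  end.

Lemma Phi_linear n : linear (@Phi n).
Proof. by case: n => [|[|n]] a f g //=; rewrite !linearP. Qed.

HB.instance Definition _ n :=
  GRing.isLinear.Build k (C n) (CAvO n) *:%R (@Phi n) (@Phi_linear n).

Definition CAvA n : lmodType k :=
  match n with
  | 0 => C 0
  | m.+1 => (C m.+1 * CAvO m)%type
  end.

Definition dAvA n : CAvA n -> CAvA n.+1 :=
  match n with
  | 0 => fun f => (delta f, Phi f)
  | m.+1 => fun fg => (delta fg.1, (-1) ^+ m.+1 *: Phi fg.1 + dAvO fg.2)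
  end.

Lemma dAvA_linear n : linear (@dAvA n).
Proof.
case: n => [|n] a f g; first by rewrite /= !linearP.
apply: (congr2 pair); first exact: linearP.
change ((-1) ^+ n.+1 *: Phi (a *: f.1 + g.1) + dAvO (a *: f.2 + g.2) =
  a *: ((-1) ^+ n.+1 *: Phi f.1 + dAvO f.2)
  + ((-1) ^+ n.+1 *: Phi g.1 + dAvO g.2)).
by rewrite Phi_linear dAvO_linear !scalerDr !scalerA [_ ^+ _ * a]mulrC addrACA.
Qed.

HB.instance Definition _ n :=
  GRing.isLinear.Build k (CAvA n) (CAvA n.+1) *:%R (@dAvA n) (@dAvA_linear n).

Definition cocycle_pred n : {pred CAvA n} := fun c => dAvA c == 0.

Lemma cocycle_pred_submod n : submod_closed (@cocycle_pred n).
Proof.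
split=> [|a c c' /eqP dc /eqP dc']; rewrite /cocycle_pred unfold_in ?linear0 //.
by rewrite dAvA_linear dc dc' scaler0 addr0.
Qed.

HB.instance Definition _ n :=
  GRing.isSubmodClosed.Build k (CAvA n) (@cocycle_pred n)
    (@cocycle_pred_submod n).

Record cocycle n := Cocycle {
  cocycle_val :> CAvA n;
  cocycleP : cocycle_val \in @cocycle_pred n }.

HB.instance Definition _ n := [isSub for @cocycle_val n].
HB.instance Definition _ n := [Choice of cocycle n by <:].
HB.instance Definition _ n := [SubChoice_isSubLmodule of cocycle n by <:].

(* The boundaries in Ker d, that is Im d since d o d = 0; this last identity is
   not needed to form the quotient. *)
Definition coboundary_pred n : {pred cocycle n} :=
  match n with
  | 0 => fun z => z == 0
  | m.+1 => fun z => `[< exists b : CAvA m, dAvA b = cocycle_val z >]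
  end.

Lemma coboundary_pred_zmod n : zmod_closed (@coboundary_pred n).
Proof.
case: n => [|n]; split; rewrite /coboundary_pred ?unfold_in //=.
- by move=> x y /eqP-> /eqP->; rewrite !unfold_in subrr.
- by apply/asboolP; exists 0; rewrite linear0.
move=> x y /asboolP[b bx] /asboolP[c cy]; apply/asboolP.
by exists (b - c); rewrite -[RHS]/(cocycle_val x - cocycle_val y) -bx -cy;
  exact: linearB.
Qed.

HB.instance Definition _ n :=
  GRing.isZmodClosed.Build (cocycle n) (@coboundary_pred n)
    (@coboundary_pred_zmod n).

Definition HAvA n := {ideal_quot (@coboundary_pred n)}.

End Complex.

(* The degree 2 cochain (psi, chi) of a section s, where
   psi(x, y) = s(x)s(y) - s(xy) and chi(x) = A^(s(x)) - s(A(x)), both in the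
   image of M. *)
Definition is_section_cochain (k : fieldType) (R : avgAlg k) (M : lmodType k)
    (AM : {linear M -> M}) (E : abext R AM) (s : {linear R -> E})
    (c : CAvA R M 2) :=
  (forall x : {ffun 'I_2 -> R}, ext_i E (c.1 x) =
     avg_mul (s (x ord0)) (s (x ord_max)) - s (avg_mul (x ord0) (x ord_max))) /\
  (forall x : {ffun 'I_1 -> R}, ext_i E (c.2 x) =
     avg_op (s (x ord0)) - s (avg_op (x ord0))).

(* Main.v *)
(* A linear section s of an abelian extension exists over a field, and its
   cochain (psi, chi) is a 2-cocycle: evaluating (s(x)s(y))s(z) = s(x)(s(y)s(z))
   and the two averaging identities on s(x), s(y) gives exactly the components
   of d(psi, chi) = 0.  Replacing s by s + f with f : R -> M adds d(f, 0), and
   since d(f, m) = d(f - delta m, 0), every coboundary arises this way; so the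
   class is independent of s, and extensions with the same class have sections
   with the same cochain, hence are isomorphic.  Conversely a cocycle twists
   R * M into an extension. *)
Require Import Defs.
From HB Require Import structures.
From mathcomp Require Import all_boot all_algebra.
From mathcomp Require Import boolp classical_sets functions.

Set Implicit Arguments.
Unset Strict Implicit.
Unset Printing Implicit Defensive.

Import GRing.Theory.
Local Open Scope ring_scope.
Local Open Scope quotient_scope.

(** * Linear splittings of surjections between vector spaces *)

Section Splitting.
Local Open Scope classical_set_scope.
Variables (k : fieldType) (V W : lmodType k) (p : {linear V -> W}).

(* A subspace maximal among those that meet ker p trivially is a complement of
   ker p.  The empty set counts as a subspace, so that unions of empty
   chains need no special treatment. *)
Lemma linear_splitting : (forall w, exists v, p v = w) ->
  exists s : {linear W -> V}, forall w, p (s w) = w.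
Proof.
move=> p_surj.
pose P (G : set V) := (forall a u v, G u -> G v -> G (a *: u + v)) /\
  (forall u, G u -> p u = 0 -> u = 0).
have [F FP Ftot|G [[Glin Gker] Gmax]] := @Zorn_bigcup V P.
  split=> [a u v [X FX Xu] [Y FY Yv]|u [X FX Xu]]; last exact: (FP _ FX).2.
  have [XY|YX] := Ftot _ _ FX FY.
    by exists Y => //; apply: (FP _ FY).1 => //; apply: XY.
  by exists X => //; apply: (FP _ FX).1 => //; apply: YX.
(* [G] may be empty, so 0 is adjoined by hand; [G0] is a genuine subspace on which [p] is
   injective. *)
pose G0 v := G v \/ v = 0.
have G0ker g : G0 g -> p g = 0 -> g = 0 by case=> // /Gker.
have G0lin a g h : G0 g -> G0 h -> G0 (a *: g + h).
  move=> [Gg|->] [Gh|->]; rewrite ?scaler0 ?add0r ?addr0; try by [left|right].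
    by left; apply: Glin.
  (* Closure of [G] is only known for sums [a *: u + v] of two members, so a multiple of [g] is
     written as such a sum. *)
  left; have -> : a *: g = (a - 1) *: g + g by rewrite scalerBl scale1r subrK.
  exact: Glin.
have G0_surj w : exists v, G0 v /\ p v = w.
  have [v pv] := p_surj w; apply: contrapT => notG.
  (* If [w] were missed, adjoining [v] to [G0] would contradict maximality: [g + b *: v] in the
     kernel with [b] nonzero would make [w] the image of [- b^-1 *: g]. *)
  pose H x := exists2 g, G0 g & exists b, x = g + b *: v.
  have GH : G `<=` H.
    by move=> g Gg; exists g; [left|exists 0; rewrite scale0r addr0].
  have coef0 b g : G0 g -> p (g + b *: v) = 0 -> b = 0.
    move=> Gg; rewrite linearD linearZ /= pv => /eqP.
    rewrite addr_eq0 => /eqP pg.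
    apply/eqP; apply: contra_notT notG => bN0; exists (- b^-1 *: g + 0); split.
      by apply: G0lin => //; right.
    by rewrite addr0 linearZ /= pg scaleNr scalerN opprK scalerA mulVf ?scale1r.
  apply: (Gmax H).
    split=> // HG; apply: notG; exists v; split=> //; left; apply: HG.
    by exists 0; [right|exists 1; rewrite add0r scale1r].
  split=> [a _ _ [g Gg [b ->]] [h Gh [c ->]]|_ [g Gg [b ->]] eq0].
    exists (a *: g + h); first exact: G0lin.
    by exists (a * b + c); rewrite scalerDr scalerA scalerDl addrACA.
  have b0 := coef0 _ _ Gg eq0; move: eq0; rewrite b0 scale0r addr0.
  exact: G0ker.
have [s sP] := choice G0_surj.
(* Preimages chosen in [G0] depend linearly on [w], because [p] is injective on [G0]. *)
have s_lin : linear s.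
  move=> a u v; apply/subr0_eq; rewrite -scaleN1r [LHS]addrC; apply: G0ker.
    by do !apply: (G0lin _ _ _ _ _); apply: (sP _).1.
  by rewrite linearP /= linearP /= !(sP _).2 scaleN1r addNr.
pose sM := GRing.isLinear.Build k W V *:%R s s_lin.
pose sL : {linear W -> V} := HB.pack s sM.
by exists sL => w; apply: (sP w).2.
Qed.

End Splitting.

(** * Cochains of degree at most 3 as functions of listed arguments *)

Section LowDegree.
Variables (k : fieldType) (R : lmodType k).

(** A list of arguments makes updates and faces computable. The default value 0 of [nth] is not
    reached when [s] has length [n]. *)
Definition vec n (s : seq R) : {ffun 'I_n -> R} := [ffun i : 'I_n => s`_i].

Lemma vec1E (x : {ffun 'I_1 -> R}) : x = vec 1 [:: x ord0].
Proof. by apply/ffunP => i; rewrite ffunE ord1. Qed.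

Lemma vec2E (x : {ffun 'I_2 -> R}) : x = vec 2 [:: x ord0; x ord_max].
Proof.
apply/ffunP => i; rewrite ffunE; case: i => [[|[|i]] lti] //=; congr (x _);
  exact: val_inj.
Qed.

Lemma vec3E (x : {ffun 'I_3 -> R}) :
  x = vec 3 [:: x ord0; x (lift ord0 ord0); x ord_max].
Proof.
apply/ffunP => i; rewrite ffunE; case: i => [[|[|[|i]]] lti] //=; congr (x _);
  exact: val_inj.
Qed.

Lemma vec_upd n (s : seq R) (i : 'I_n) u : size s = n ->
  ffun_upd (vec n s) i u = vec n (set_nth 0 s i u).
Proof. by move=> sz_s; apply/ffunP => j; rewrite !ffunE nth_set_nth. Qed.

Variable M : lmodType k.

Lemma mlin1_linear (f : mlin R M 1) : linear (fun x => f (vec 1 [:: x])).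
Proof.
move=> a u v; have := mlinP f (vec 1 [:: 0]) ord0 a u v.
by rewrite !vec_upd.
Qed.

Lemma mlin2_linearl (f : mlin R M 2) y : linear (fun x => f (vec 2 [:: x; y])).
Proof.
move=> a u v; have := mlinP f (vec 2 [:: 0; y]) ord0 a u v.
by rewrite !vec_upd.
Qed.

Lemma mlin2_linearr (f : mlin R M 2) x : linear (fun y => f (vec 2 [:: x; y])).
Proof.
move=> a u v; have := mlinP f (vec 2 [:: x; 0]) ord_max a u v.
by rewrite !vec_upd.
Qed.

Lemma linear1_multilinear (f : R -> M) : linear f ->
  multilinear (fun x : {ffun 'I_1 -> R} => f (x ord0)).
Proof. by move=> fl x i a u v; rewrite [i]ord1 !ffunE eqxx fl. Qed.

Lemma bilinear_multilinear (f : R -> R -> M) : bilinear_for *:%R *:%R f ->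
  multilinear (fun x : {ffun 'I_2 -> R} => f (x ord0) (x ord_max)).
Proof.
move=> [fl fr] x i a u v; rewrite !ffunE.
by case: i => [[|[|i]] lti] //=; rewrite -?val_eqE /= ?fl ?fr.
Qed.

End LowDegree.

(** * The differentials in low degree and the 2-cocycle equations *)

Section Formulas.
Variables (k : fieldType) (R : avgAlg k) (M : lmodType k).
Variable AM : {linear M -> M}.
Variable B : avgBimod R AM.

Lemma delta1E (f : mlin R M 1) x y : delta B f (vec 2 [:: x; y]) =
  lact B x (f (vec 1 [:: y])) - f (vec 1 [:: avg_mul x y])
  + ract B (f (vec 1 [:: x])) y.
Proof.
rewrite /= /delta_fun big_ord1 expr1 scaleN1r sqrrN expr1n scale1r !ffunE.
congr (lact B x (f _) - f _ + ract B (f _) y);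
  by rewrite [LHS]vec1E; congr vec; rewrite !ffunE.
Qed.

Lemma delta2E (f : mlin R M 2) x y z : delta B f (vec 3 [:: x; y; z]) =
  lact B x (f (vec 2 [:: y; z])) - f (vec 2 [:: avg_mul x y; z])
  + f (vec 2 [:: x; avg_mul y z]) - ract B (f (vec 2 [:: x; y])) z.
Proof.
rewrite /= /delta_fun !big_ord_recl big_ord0 addr0 /= /bump /= !addn0.
rewrite expr1 sqrrN expr1n (exprS _ 2) sqrrN expr1n mulr1 !scaleN1r scale1r.
rewrite !ffunE addrA.
congr (lact B x (f _) - f _ + f _ - ract B (f _) z);
  by rewrite [LHS]vec2E; congr vec; rewrite !ffunE.
Qed.

Lemma dr1E (f : mlin R M 1) x y : dr B f (vec 2 [:: x; y]) =
  lact B (avg_op x) (f (vec 1 [:: y])) - AM (lact B x (f (vec 1 [:: y])))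
  - f (vec 1 [:: avg_mul x (avg_op y)])
  + ract B (f (vec 1 [:: x])) (avg_op y).
Proof.
rewrite /= /dr_fun big_ord1 expr1 scaleN1r sqrrN expr1n scale1r !ffunE.
congr (lact B _ (f _) - AM (lact B x (f _)) - f _ + ract B (f _) _);
  by rewrite [LHS]vec1E; congr vec; rewrite !ffunE.
Qed.

Lemma dl1E (f : mlin R M 1) x y : dl B f (vec 2 [:: x; y]) =
  lact B (avg_op x) (f (vec 1 [:: y])) - f (vec 1 [:: avg_mul (avg_op x) y])
  + ract B (f (vec 1 [:: x])) (avg_op y) - AM (ract B (f (vec 1 [:: x])) y).
Proof.
rewrite /= /dl_fun big_ord1 expr1 !scaleN1r sqrrN expr1n scale1r !ffunE.
congr (lact B _ (f _) - f _ + ract B (f _) _ - AM (ract B (f _) _));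
  by rewrite [LHS]vec1E; congr vec; rewrite !ffunE.
Qed.

Lemma Phi1E (f : mlin R M 1) x :
  Phi AM f (vec 1 [:: x]) = f (vec 1 [:: avg_op x]) - AM (f (vec 1 [:: x])).
Proof.
by rewrite /= /Phir_fun; congr (f _ - AM (f _)); rewrite [LHS]vec1E; congr vec;
  rewrite !ffunE.
Qed.

Lemma Phir2E (f : mlin R M 2) x y : Phir AM f (vec 2 [:: x; y]) =
  f (vec 2 [:: avg_op x; avg_op y]) - AM (f (vec 2 [:: x; avg_op y])).
Proof.
by rewrite /= /Phir_fun; congr (f _ - AM (f _)); rewrite [LHS]vec2E; congr vec;
  rewrite !ffunE.
Qed.

Lemma Phil2E (f : mlin R M 2) x y : Phil AM f (vec 2 [:: x; y]) =
  f (vec 2 [:: avg_op x; avg_op y]) - AM (f (vec 2 [:: avg_op x; y])).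
Proof.
by rewrite /= /Phil_fun; congr (f _ - AM (f _)); rewrite [LHS]vec2E; congr vec;
  rewrite !ffunE.
Qed.

Lemma d0E (m : mlin R M 0) x : d0 B m (vec 1 [:: x]) =
  AM (ract B (m (vec 0 [::])) x) - AM (lact B x (m (vec 0 [::])))
  - ract B (m (vec 0 [::])) (avg_op x) + lact B (avg_op x) (m (vec 0 [::])).
Proof.
rewrite /= /d0_fun /=; have -> : ffun_tail (vec 1 [:: x]) = vec 0 [::].
  by apply/ffunP => -[].
by rewrite !ffunE.
Qed.

Lemma delta0E (m : mlin R M 0) x : delta B m (vec 1 [:: x]) =
  lact B x (m (vec 0 [::])) - ract B (m (vec 0 [::])) x.
Proof.
rewrite /= /delta_fun big_ord0 addr0 expr1 scaleN1r !ffunE.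
by congr (lact B x (m _) - ract B (m _) x); apply/ffunP => -[].
Qed.

Lemma eq_mlin n (f g : mlin R M n) : (forall x, f x = g x) -> f = g.
Proof. by move=> fg; apply/val_inj/funext. Qed.

(** The subtraction-free form is the one met in [R * M]: the three equations are the M-coordinates
    of associativity and of the two averaging identities. *)
Lemma cocycle2P (c : CAvA R M 2) : c \in cocycle_pred B (n:=2) <->
  [/\ forall x y z,
        lact B x (c.1 (vec 2 [:: y; z])) + c.1 (vec 2 [:: x; avg_mul y z]) =
        ract B (c.1 (vec 2 [:: x; y])) z + c.1 (vec 2 [:: avg_mul x y; z]),
      forall x y,
        lact B (avg_op x) (c.2 (vec 1 [:: y]))
        + ract B (c.2 (vec 1 [:: x])) (avg_op y)
        + c.1 (vec 2 [:: avg_op x; avg_op y]) =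
        AM (lact B x (c.2 (vec 1 [:: y]))) + AM (c.1 (vec 2 [:: x; avg_op y]))
        + c.2 (vec 1 [:: avg_mul x (avg_op y)])
    & forall x y,
        lact B (avg_op x) (c.2 (vec 1 [:: y]))
        + ract B (c.2 (vec 1 [:: x])) (avg_op y)
        + c.1 (vec 2 [:: avg_op x; avg_op y]) =
        AM (ract B (c.2 (vec 1 [:: x])) y) + AM (c.1 (vec 2 [:: avg_op x; y]))
        + c.2 (vec 1 [:: avg_mul (avg_op x) y])].
Proof.
have sgn : (-1) ^+ 2 = 1 :> k by rewrite sqrrN expr1n.
have -> : c \in cocycle_pred B (n:=2) <-> [/\ delta B c.1 = 0,
    Phir AM c.1 + dr B c.2 = 0 & Phil AM c.1 + dl B c.2 = 0].
  rewrite unfold_in /cocycle_pred /= sgn scale1r.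
  split=> [/eqP e|[d1 d2 d3]].
    split; [exact: (congr1 fst e)|exact: (congr1 (fst \o snd) e)|].
    exact: (congr1 (snd \o snd) e).
  by apply/eqP/(congr2 pair) => //; apply: (congr2 pair).
(* In each component the [AC] pattern collects the positive terms, then the negative ones, which
   become the two sides of the equation. *)
have eq1 x y z : (delta B c.1 (vec 3 [:: x; y; z]) = 0) <->
  (lact B x (c.1 (vec 2 [:: y; z])) + c.1 (vec 2 [:: x; avg_mul y z]) =
   ract B (c.1 (vec 2 [:: x; y])) z + c.1 (vec 2 [:: avg_mul x y; z])).
  rewrite delta2E [X in X = 0](AC 4 ((1*3)*(4*2))) /= -opprD.
  by split=> [/subr0_eq|->]; rewrite ?subrr.
have eq2 x y : ((Phir AM c.1 + dr B c.2) (vec 2 [:: x; y]) = 0) <->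
  (lact B (avg_op x) (c.2 (vec 1 [:: y]))
   + ract B (c.2 (vec 1 [:: x])) (avg_op y)
   + c.1 (vec 2 [:: avg_op x; avg_op y]) =
   AM (lact B x (c.2 (vec 1 [:: y]))) + AM (c.1 (vec 2 [:: x; avg_op y]))
   + c.2 (vec 1 [:: avg_mul x (avg_op y)])).
  rewrite [X in X = 0](_ : _ = Phir AM c.1 (vec 2 [:: x; y])
    + dr B c.2 (vec 2 [:: x; y])) // Phir2E dr1E.
  rewrite [X in X = 0](AC (2*4) (((3*6)*1)*((4*2)*5))) /= -!opprD.
  by split=> [/subr0_eq|->]; rewrite ?subrr.
have eq3 x y : ((Phil AM c.1 + dl B c.2) (vec 2 [:: x; y]) = 0) <->
  (lact B (avg_op x) (c.2 (vec 1 [:: y]))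
   + ract B (c.2 (vec 1 [:: x])) (avg_op y)
   + c.1 (vec 2 [:: avg_op x; avg_op y]) =
   AM (ract B (c.2 (vec 1 [:: x])) y) + AM (c.1 (vec 2 [:: avg_op x; y]))
   + c.2 (vec 1 [:: avg_mul (avg_op x) y])).
  rewrite [X in X = 0](_ : _ = Phil AM c.1 (vec 2 [:: x; y])
    + dl B c.2 (vec 2 [:: x; y])) // Phil2E dl1E.
  rewrite [X in X = 0](AC (2*4) (((3*5)*1)*((6*2)*4))) /= -!opprD.
  by split=> [/subr0_eq|->]; rewrite ?subrr.
split=> [[d1 d2 d3]|[d1 d2 d3]].
  split=> [x y z|x y|x y].
  - by apply/eq1; rewrite d1.
  - by apply/eq2; rewrite d2.
  - by apply/eq3; rewrite d3.
split; apply: eq_mlin => x.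
- by rewrite [x]vec3E; apply/eq1.
- by rewrite [x]vec2E; apply/eq2.
- by rewrite [x]vec2E; apply/eq3.
Qed.

Lemma eq_cochain2 (c c' : CAvA R M 2) :
  (forall x y, c.1 (vec 2 [:: x; y]) = c'.1 (vec 2 [:: x; y])) ->
  (forall x, c.2 (vec 1 [:: x]) = c'.2 (vec 1 [:: x])) -> c = c'.
Proof.
case: c c' => [f g] [f' g'] /= ff gg; congr pair; apply: eq_mlin => x.
  by rewrite [x]vec2E.
by rewrite [x]vec1E.
Qed.

Definition cochain1 (f : mlin R M 1) (m : mlin R M 0) : CAvA R M 1 := (f, m).

Lemma dAvA1E1 f m x y : (dAvA B (cochain1 f m)).1 (vec 2 [:: x; y]) =
  lact B x (f (vec 1 [:: y])) - f (vec 1 [:: avg_mul x y])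
  + ract B (f (vec 1 [:: x])) y.
Proof. exact: delta1E. Qed.

(** The sign [(-1) ^+ 1] reverses Phi^1(f) = f o A - A_M o f. *)
Lemma dAvA1E2 f m x : (dAvA B (cochain1 f m)).2 (vec 1 [:: x]) =
  AM (f (vec 1 [:: x])) - f (vec 1 [:: avg_op x]) + d0 B m (vec 1 [:: x]).
Proof.
rewrite -opprB -Phi1E.
rewrite [LHS](_ : _ = (-1) ^+ 1 *: Phi AM f (vec 1 [:: x])
  + d0 B m (vec 1 [:: x])) //.
by rewrite expr1 scaleN1r.
Qed.

(** As Phi^0 is the identity, the pair is the differential of [m], and this is d o d = 0 in degree
    0. The first component cancels by the bimodule axioms, the second by the choice of signs in
    [d0]. *)
Lemma dAvA_dAvA0 (m : mlin R M 0) : dAvA B (cochain1 (delta B m) m) = 0.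
Proof.
apply: eq_cochain2 => [x y|x].
  rewrite dAvA1E1 !delta0E !(linearBl, linearBr) /= lactA lractA ractA opprB.
  by rewrite [LHS](AC (2*2*2) ((1*4)*((5*2)*(3*6)))) /= !subrr !addr0.
rewrite dAvA1E2 d0E !delta0E linearB /=.
set a := AM _; set b := AM _; set c := lact _ _ _; set d := ract _ _ _.
rewrite opprB [LHS](AC (2*2*4) ((1*6)*((5*2)*((3*7)*(8*4))))) /=.
by rewrite !subrr !addr0.
Qed.

Lemma dAvA1_normalize f m :
  dAvA B (cochain1 f m) = dAvA B (cochain1 (f - delta B m) 0).
Proof.
apply/subr0_eq; rewrite -[RHS](dAvA_dAvA0 m) -linearB.
by congr (dAvA B _); congr pair; rewrite /= ?subr0 // opprB addrC subrK.
Qed.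

Lemma dAvA1_0E2 f x : (dAvA B (cochain1 f 0)).2 (vec 1 [:: x]) =
  AM (f (vec 1 [:: x])) - f (vec 1 [:: avg_op x]).
Proof. by rewrite dAvA1E2 linear0 addr0. Qed.

End Formulas.

(** * Bundling linear and bilinear maps *)

Section Packing.
Variables (k : fieldType) (U V W : lmodType k).

Definition pack_linear (f : U -> V) (fl : linear f) : {linear U -> V} :=
  HB.pack f (GRing.isLinear.Build k U V *:%R f fl).

Definition pack_bilinear (f : U -> V -> W) (fl : bilinear_for *:%R *:%R f) :
    {bilinear U -> V -> W} :=
  HB.pack f (bilinear_isBilinear.Build k U V W *:%R *:%R f fl).

End Packing.

(** * The action on the kernel of an extension, and the cochain of a section *)

Section Extension.
Variables (k : fieldType) (R : avgAlg k) (M : lmodType k).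
Variable AM : {linear M -> M}.
Variable E : abext R AM.
Local Notation i := (ext_i E).
Local Notation p := (ext_p E).
Local Notation A := (@avg_op k _).
Local Notation "x ** y" := (@avg_mul k _ x y) (at level 40, left associativity).
Implicit Types (B : avgBimod R AM) (s : {linear R -> E}).

Lemma ext_i_mul m n : i m ** i n = 0.
Proof. by rewrite -(ext_i_hom E).1; apply: linear0. Qed.

Lemma ext_iA m : i (AM m) = A (i m).
Proof. by rewrite -(ext_i_hom E).2. Qed.

Lemma ext_pi m : p (i m) = 0.
Proof. by apply/ext_exact; exists m. Qed.

(** The difference [x - y] lies in the image of M, where products vanish; so the action on M factors
    through R. *)
Lemma eq_mul_i x y m : p x = p y -> x ** i m = y ** i m.
Proof.
move=> pxy; have /ext_exact[n in_xy] : p (x - y) = 0.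
  by rewrite linearB pxy subrr.
by rewrite -[x](subrK y) -in_xy linearDl ext_i_mul add0r.
Qed.

Lemma eq_i_mul x y m : p x = p y -> i m ** x = i m ** y.
Proof.
move=> pxy; have /ext_exact[n in_xy] : p (x - y) = 0.
  by rewrite linearB pxy subrr.
by rewrite -[x](subrK y) -in_xy linearDr ext_i_mul add0r.
Qed.

(** [q] is the M-coordinate in the decomposition of the extension given by [s]. *)
Lemma section_retraction s : is_section s ->
  exists q : {linear E -> M}, forall x, i (q x) = x - s (p x).
Proof.
move=> sP; have ker x : exists m, i m = x - s (p x).
  by apply/ext_exact; rewrite linearB /= sP subrr.
have [q qP] := choice ker.
have ql : linear q.
  move=> a u v; apply: (@ext_i_inj _ _ _ _ E).
  by rewrite linearP !qP !linearP /= scalerDr addrACA.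
by exists (pack_linear ql).
Qed.

Lemma section_exists : exists s : {linear R -> E}, is_section s.
Proof. exact: linear_splitting (@ext_p_surj _ _ _ _ E). Qed.

(** A section need be neither multiplicative nor compatible with the operators, but [s (r ** r')]
    and [s r ** s r'], or [s (A r)] and [A (s r)], agree under [p] and hence act alike on M. The
    axioms then follow from those of the extension by injectivity of [i]. *)
Lemma induces_exists : exists B, induces E B.
Proof.
have [s sP] := section_exists; have [q qP] := section_retraction sP.
have opP : is_avg_hom p := ext_p_hom E.
have i_inj := @ext_i_inj _ _ _ _ E.
pose l r m := q (s r ** i m); pose t m r := q (i m ** s r).
have il r m : i (l r m) = s r ** i m.
  by rewrite qP opP.1 ext_pi linear0r linear0 subr0.
have it m r : i (t m r) = i m ** s r.
  by rewrite qP opP.1 ext_pi linear0l linear0 subr0.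
have lb : bilinear_for *:%R *:%R l.
  by split=> z a x y; rewrite /l !(linearP, linearPl, linearPr).
have tb : bilinear_for *:%R *:%R t.
  by split=> z a x y; rewrite /t !(linearP, linearPl, linearPr).
have sM r r' : p (s (r ** r')) = p (s r ** s r') by rewrite opP.1 !sP.
have sA r : p (s (A r)) = p (A (s r)) by rewrite opP.2 !sP.
have lA r r' m : l (r ** r') m = l r (l r' m).
  by apply: i_inj; rewrite !il avg_mulA; apply: eq_mul_i.
have ltA r m r' : t (l r m) r' = l r (t m r').
  by apply: i_inj; rewrite !(il, it) avg_mulA.
have tA m r r' : t m (r ** r') = t (t m r) r'.
  by apply: i_inj; rewrite !it -avg_mulA; apply: eq_i_mul.
have l_opl r m : l (A r) (AM m) = AM (l (A r) m).
  by apply: i_inj; rewrite ext_iA !il !(eq_mul_i _ (sA r)) ext_iA avg_opl.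
have l_opr r m : l (A r) (AM m) = AM (l r (AM m)).
  by apply: i_inj; rewrite ext_iA !il (eq_mul_i _ (sA r)) ext_iA avg_opr.
have t_opl m r : t (AM m) (A r) = AM (t (AM m) r).
  by apply: i_inj; rewrite ext_iA !it (eq_i_mul _ (sA r)) ext_iA avg_opl.
have t_opr m r : t (AM m) (A r) = AM (t m (A r)).
  by apply: i_inj; rewrite ext_iA !it !(eq_i_mul _ (sA r)) ext_iA avg_opr.
exists (@AvgBimod k R M AM (pack_bilinear lb) (pack_bilinear tb)
          lA ltA tA l_opl l_opr t_opl t_opr).
by exists s.
Qed.

Variable B : avgBimod R AM.
Hypothesis EB : induces E B.

(** [EB] provides one section, but any lift acts in the same way, so [B] is computed by every
    section. *)
Lemma ext_i_lact x m : i (lact B (p x) m) = x ** i m.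
Proof.
by have [s sP sB] := EB; rewrite (sB _ _).1; apply: eq_mul_i; rewrite sP.
Qed.

Lemma ext_i_ract x m : i (ract B m (p x)) = i m ** x.
Proof.
by have [s sP sB] := EB; rewrite (sB _ _).2; apply: eq_i_mul; rewrite sP.
Qed.

Variables (s : {linear R -> E}).
Hypothesis sP : is_section s.

Lemma section_lact r m : i (lact B r m) = s r ** i m.
Proof. by rewrite -[r in LHS]sP ext_i_lact. Qed.

Lemma section_ract m r : i (ract B m r) = i m ** s r.
Proof. by rewrite -[r in LHS]sP ext_i_ract. Qed.

Lemma section_cochain_exists : exists c : CAvA R M 2, is_section_cochain s c.
Proof.
have [q qP] := section_retraction sP; have opP : is_avg_hom p := ext_p_hom E.
have psi_b : bilinear_for *:%R *:%R (fun x y => q (s x ** s y)).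
  by split=> z a x y; rewrite !(linearP, linearPl, linearPr).
have chi_l : linear (fun x => q (A (s x))) by move=> a x y; rewrite !linearP.
(* Since [p (s x ** s y)] is [x ** y], the M-coordinate of [s x ** s y] is already psi; likewise
   that of [A (s x)] is chi. *)
exists (mk_mlin (bilinear_multilinear psi_b),
        mk_mlin (linear1_multilinear chi_l)).
by split=> x /=; rewrite qP ?opP.1 ?opP.2 !sP.
Qed.

End Extension.

(** * The structure of an extension read through a section *)

Section SectionCochain.
Variables (k : fieldType) (R : avgAlg k) (M : lmodType k).
Variable AM : {linear M -> M}.
Variables (E : abext R AM) (s : {linear R -> E}) (c : CAvA R M 2).
Local Notation i := (ext_i E).
Local Notation p := (ext_p E).
Local Notation A := (@avg_op k _).
Local Notation "x ** y" := (@avg_mul k _ x y) (at level 40, left associativity).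
Local Notation psi x y := (c.1 (vec 2 [:: x; y])).
Local Notation chi x := (c.2 (vec 1 [:: x])).

Lemma section_cochainP : is_section_cochain s c <->
  (forall x y, i (psi x y) = s x ** s y - s (x ** y)) /\
  (forall x, i (chi x) = A (s x) - s (A x)).
Proof.
split=> -[c1 c2]; split.
- by move=> x y; rewrite c1 !ffunE.
- by move=> x; rewrite c2 !ffunE.
- by move=> x; rewrite {1}[x]vec2E c1.
- by move=> x; rewrite {1}[x]vec1E c2.
Qed.

Hypothesis sc : is_section_cochain s c.

Lemma section_cochain_uniq c' : is_section_cochain s c' -> c' = c.
Proof.
have [c1 c2] := (iffLR section_cochainP sc).
move=> [c'1 c'2]; apply: eq_cochain2 => [x y|x]; apply: (@ext_i_inj _ _ _ _ E).
  by rewrite c1 c'1 !ffunE.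
by rewrite c2 c'2 !ffunE.
Qed.

Variable B : avgBimod R AM.
Hypotheses (EB : induces E B) (sP : is_section s).

(** In the coordinates [(a, m)] the product depends only on [B] and [c]; [section_op] says the same
    of the operator. *)
Lemma section_mul a b m n : (s a + i m) ** (s b + i n) =
  s (a ** b) + i (lact B a n + ract B m b + psi a b).
Proof.
have [c1 _] := (iffLR section_cochainP sc).
rewrite linearDl !linearDr !linearD /= ext_i_mul addr0 c1.
rewrite (section_lact EB sP) (section_ract EB sP).
by rewrite addrCA [s _ + _]addrCA subrr addr0 -addrA addrC.
Qed.

Lemma section_op a m : A (s a + i m) = s (A a) + i (AM m + chi a).
Proof.
have [_ c2] := (iffLR section_cochainP sc).
by rewrite !linearD /= c2 ext_iA addrCA [s _ + _]addrC subrK addrC.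
Qed.

Lemma section_cocycle : c \in cocycle_pred B (n:=2).
Proof.
have [c1 c2] := (iffLR section_cochainP sc).
(* Lifting [A x] by [A (s x)] rather than [s (A x)] makes the sums below telescope, leaving the
   averaging identities of [E] at [s x] and [s y]. *)
have lactA x m : i (lact B (A x) m) = A (s x) ** i m.
  by rewrite (section_lact EB sP); apply: eq_mul_i; rewrite (ext_p_hom E).2 !sP.
apply/cocycle2P; split=> [x y z|x y|x y]; apply: (@ext_i_inj _ _ _ _ E);
  rewrite !linearD /= ?ext_iA !(lactA, section_lact EB sP, section_ract EB sP);
  rewrite !(c1, c2) linearBr linearBl /=.
- by rewrite !subrKA !avg_mulA.
- by rewrite linearBr 2![A (_ - _)]linearB /= !subrKA !avg_opr.
- by rewrite linearBl 2![A (_ - _)]linearB /= !subrKA !avg_opl.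
Qed.

End SectionCochain.

(** The product of the two added terms vanishes in M, so psi changes by an expression linear in [f],
    namely delta f, while chi changes by A_M o f - f o A. *)
Lemma section_shift (k : fieldType) (R : avgAlg k) (M : lmodType k)
    (AM : {linear M -> M}) (E : abext R AM) (B : avgBimod R AM)
    (s s' : {linear R -> E}) (c : CAvA R M 2) (f : mlin R M 1) :
  induces E B -> is_section s -> is_section_cochain s c ->
  (forall x, s' x = s x + ext_i E (f (vec 1 [:: x]))) ->
  is_section_cochain s' (c + dAvA B (cochain1 f 0)).
Proof.
move=> EB sP sc s'E; have [c1 c2] := iffLR (section_cochainP _ _) sc.
apply/section_cochainP; split=> [x y|x].
  rewrite -[(c + _).1]/(c.1 + (dAvA B (cochain1 f 0)).1).
  rewrite -[(c.1 + _) _]/(c.1 _ + (dAvA B (cochain1 f 0)).1 _) dAvA1E1.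
  rewrite linearD /= c1 !linearD linearN /= !s'E.
  rewrite (section_lact EB sP) (section_ract EB sP).
  rewrite linearDl !linearDr /= ext_i_mul addr0.
  by rewrite opprD [LHS](AC (2*3) (((1*3)*5)*(2*4))).
rewrite -[(c + _).2]/(c.2 + (dAvA B (cochain1 f 0)).2).
rewrite -[(c.2 + _) _]/(c.2 _ + (dAvA B (cochain1 f 0)).2 _) dAvA1_0E2.
rewrite linearD /= c2 linearB /= !s'E linearD /= ext_iA opprD.
by rewrite addrACA.
Qed.

(** * Isomorphisms of extensions against changes of section *)

Section Comparison.
Variables (k : fieldType) (R : avgAlg k) (M : lmodType k).
Variable AM : {linear M -> M}.
Variable B : avgBimod R AM.
Implicit Types E : abext R AM.

Lemma section_decomp E (s : {linear R -> E}) x : is_section s ->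
  exists r m, x = s r + ext_i E m.
Proof.
move=> sP; have [q qP] := section_retraction sP.
by exists (ext_p E x), (q x); rewrite qP addrC subrK.
Qed.

Lemma comparison_map E1 E2 (s1 : {linear R -> E1}) (s2 : {linear R -> E2}) :
  is_section s1 -> exists zeta : {linear E1 -> E2},
    forall r m, zeta (s1 r + ext_i E1 m) = s2 r + ext_i E2 m.
Proof.
move=> s1P; have [q qP] := section_retraction s1P.
have zl : linear (fun x => s2 (ext_p E1 x) + ext_i E2 (q x)).
  by apply: linear_addf => a u v; rewrite !linearP.
exists (pack_linear zl) => r m /=.
have pE : ext_p E1 (s1 r + ext_i E1 m) = r.
  by rewrite linearD /= s1P ext_pi addr0.
rewrite pE; congr (_ + ext_i E2 _); apply: (@ext_i_inj _ _ _ _ E1).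
by rewrite qP pE addrC addKr.
Qed.

(** Both extensions obey the same formulas in the coordinates of their sections, so matching
    coordinates is an isomorphism. *)
Lemma same_cochain_iso E1 E2 (s1 : {linear R -> E1}) (s2 : {linear R -> E2})
    (c : CAvA R M 2) :
  induces E1 B -> induces E2 B -> is_section s1 -> is_section s2 ->
  is_section_cochain s1 c -> is_section_cochain s2 c -> ext_iso E1 E2.
Proof.
move=> E1B E2B s1P s2P s1c s2c.
have [zeta zetaE] := comparison_map s2 s1P.
have [zeta' zeta'E] := comparison_map s1 s2P.
exists zeta; split.
- split=> [x y|x].
    have [r [m ->]] := section_decomp x s1P.
    have [r' [m' ->]] := section_decomp y s1P.
    by rewrite (section_mul s1c E1B s1P) !zetaE (section_mul s2c E2B s2P).
  have [r [m ->]] := section_decomp x s1P.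
  by rewrite (section_op s1c) !zetaE (section_op s2c).
- exists zeta' => x.
    by have [r [m ->]] := section_decomp x s1P; rewrite zetaE zeta'E.
  by have [r [m ->]] := section_decomp x s2P; rewrite zeta'E zetaE.
- by move=> m; have := zetaE 0 m; rewrite !linear0 !add0r.
- move=> x; have [r [m ->]] := section_decomp x s1P.
  by rewrite zetaE !linearD /= !ext_pi s1P s2P.
Qed.

Lemma iso_section_cochain E1 E2 (s1 : {linear R -> E1}) (c : CAvA R M 2) :
  ext_iso E1 E2 -> is_section s1 -> is_section_cochain s1 c ->
  exists2 s2 : {linear R -> E2}, is_section s2 & is_section_cochain s2 c.
Proof.
move=> [zeta [[zM zA] _ zi zp]] s1P [c1 c2].
have sl : linear (fun r => zeta (s1 r)) by move=> a u v; rewrite !linearP.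
exists (pack_linear sl) => [r|]; first by rewrite zp s1P.
by split=> x /=; rewrite -zi ?c1 ?c2 linearB /= ?zM ?zA.
Qed.

Lemma sections_cohomologous E (s s' : {linear R -> E}) (c c' : CAvA R M 2) :
  induces E B -> is_section s -> is_section s' ->
  is_section_cochain s c -> is_section_cochain s' c' ->
  exists f : mlin R M 1, c' = c + dAvA B (cochain1 f 0).
Proof.
move=> EB sP s'P sc s'c'; have [q qP] := section_retraction sP.
have fl : linear (fun r => q (s' r)) by move=> a u v; rewrite !linearP.
(* The M-coordinate of [s' r] relative to [s] is [s' r - s r]. Shifting [s] by it gives [s'], whose
   cochain is unique. *)
exists (mk_mlin (linear1_multilinear fl)).
apply: (section_cochain_uniq _ s'c'); apply: (section_shift EB sP sc) => r /=.
by rewrite !ffunE qP s'P addrC subrK.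
Qed.

End Comparison.

(** * The extension on [R * M] twisted by a 2-cocycle *)

Section Realization.
Variables (k : fieldType) (R : avgAlg k) (M : lmodType k).
Variable AM : {linear M -> M}.
Variables (B : avgBimod R AM) (c : CAvA R M 2).
Hypothesis cP : c \in cocycle_pred B (n:=2).
Local Notation psi x y := (c.1 (vec 2 [:: x; y])).
Local Notation chi x := (c.2 (vec 1 [:: x])).
Local Notation T := (R * M)%type.

(** The formula of [section_mul], with [(r, m)] standing for [s r + i m]. *)
Definition twisted_mul (u v : T) : T :=
  (avg_mul u.1 v.1, lact B u.1 v.2 + ract B u.2 v.1 + psi u.1 v.1).

Definition twisted_op (u : T) : T := (avg_op u.1, AM u.2 + chi u.1).

Lemma twisted_mul_bilinear : bilinear_for *:%R *:%R twisted_mul.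
Proof.
split=> z a u v; congr pair; rewrite /= ?(linearPl, linearPr) //=.
  rewrite mlin2_linearl !scalerDr.
  by rewrite [LHS](AC (2*2*2) (((1*3)*5)*((2*4)*6))).
rewrite mlin2_linearr !scalerDr.
by rewrite [LHS](AC (2*2*2) (((1*3)*5)*((2*4)*6))).
Qed.

Lemma twisted_op_linear : linear twisted_op.
Proof.
move=> a u v; congr pair; rewrite /= ?linearP //= mlin1_linear.
by rewrite scalerDr addrACA.
Qed.

(** The terms with an entry from M match by the bimodule axioms; the others form the first cocycle
    equation. The two averaging identities below split in the same way. *)
Lemma twisted_mulA u v w :
  twisted_mul u (twisted_mul v w) = twisted_mul (twisted_mul u v) w.
Proof.
have [c1 _ _] := iffLR (cocycle2P _ _) cP.
congr pair; rewrite /= ?avg_mulA // !linearDr !linearDl /= lactA lractA ractA.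
by rewrite [LHS](AC (3*1*1) (((1*2)*4)*(3*5))) /= c1 !addrA.
Qed.

Lemma twisted_opr u v :
  twisted_mul (twisted_op u) (twisted_op v)
  = twisted_op (twisted_mul u (twisted_op v)).
Proof.
have [_ c2 _] := iffLR (cocycle2P _ _) cP.
congr pair; rewrite /= ?avg_opr // !linearDr !linearDl /= lact_opr ract_opr.
rewrite [LHS](AC (2*2*1) ((1*3)*((2*4)*5))) /= c2 !linearD /=.
by rewrite [RHS](AC (4*1) ((1*3)*((2*4)*5))).
Qed.

Lemma twisted_opl u v :
  twisted_mul (twisted_op u) (twisted_op v)
  = twisted_op (twisted_mul (twisted_op u) v).
Proof.
have [_ _ c3] := iffLR (cocycle2P _ _) cP.
congr pair; rewrite /= ?avg_opl // !linearDr !linearDl /= lact_opl ract_opl.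
rewrite [LHS](AC (2*2*1) ((1*3)*((2*4)*5))) /= c3 !linearD /=.
by rewrite [RHS](AC (1*2*1*1) ((1*2)*((3*4)*5))).
Qed.

Definition twisted_alg : avgAlg k :=
  @AvgAlg k T (pack_bilinear twisted_mul_bilinear)
    (pack_linear twisted_op_linear)
    twisted_mulA twisted_opr twisted_opl.

Lemma realization : exists (E : abext R AM) (s : {linear R -> E}),
  [/\ induces E B, is_section s & is_section_cochain s c].
Proof.
have il : linear (fun m : M => (0, m) : T).
  by move=> a u v; congr pair; rewrite /= scaler0 addr0.
have pl : linear (fun u : T => u.1) by [].
have sl : linear (fun r : R => (r, 0) : T).
  by move=> a u v; congr pair; rewrite /= scaler0 addr0.
(* These vanishings remove psi and chi wherever an element [(0, m)] is involved, so that M keeps its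
   operator, its zero product and the actions of [B]. *)
have psi0l y : psi 0 y = 0.
  exact: (linear0 (pack_linear (mlin2_linearl c.1 y))).
have psi0r x : psi x 0 = 0.
  exact: (linear0 (pack_linear (mlin2_linearr c.1 x))).
have chi0 : chi 0 = 0 by exact: (linear0 (pack_linear (mlin1_linear c.2))).
pose i : {linear zero_avgAlg AM -> twisted_alg} := pack_linear il.
pose p : {linear twisted_alg -> R} := pack_linear pl.
have i_hom : is_avg_hom i.
  split=> [m n|m]; congr pair => /=; rewrite ?linear0 ?linear0l ?linear0r //.
    by rewrite psi0l !addr0.
  by rewrite chi0 addr0.
have p_hom : is_avg_hom p by [].
have i_inj : injective i by move=> m n [].
have exact_ip x : p x = 0 <-> exists m, i m = x.
  by case: x => r m; split=> [/= ->|[_ [<-]]] //; exists m.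
have p_surj r : exists x, p x = r by exists (r, 0).
pose E := @AbExt k R M AM twisted_alg i p i_hom p_hom i_inj exact_ip p_surj.
pose s : {linear R -> E} := pack_linear sl.
exists E, s; split=> //.
  exists s => // r m; split; congr pair => /=; rewrite ?linear0l ?linear0r //.
    by rewrite psi0r !addr0.
  by rewrite psi0l add0r addr0.
apply/section_cochainP; split=> [x y|x]; congr pair => /=; rewrite ?subrr //.
  by rewrite linear0l linear0r !add0r subr0.
by rewrite linear0 add0r subr0.
Qed.

End Realization.

(** The first part places every extension over some bimodule. The last clause identifies [Theta] as
    the class of the cochain of any section, which excludes an arbitrary bijection. *)
Theorem theorem5p5 (k : fieldType) (R : avgAlg k) (M : lmodType k)
    (AM : {linear M -> M}) :
  (forall E : abext R AM, exists B : avgBimod R AM, induces E B) /\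
  (forall B : avgBimod R AM,
    exists Theta : abext_over B -> HAvA B 2,
      [/\ forall E1 E2 : abext_over B,
             Theta E1 = Theta E2 <-> ext_iso (sval E1) (sval E2),
          forall c : HAvA B 2, exists E : abext_over B, Theta E = c
        & forall (E : abext_over B) (s : {linear R -> sval E}), is_section s ->
            exists2 z : cocycle B 2, is_section_cochain s (cocycle_val z) &
              Theta E = \pi_(HAvA B 2) z]).
Proof.
split=> [E|B]; first exact: induces_exists.
have cocycle_of (E : abext_over B) (s : {linear R -> sval E}) : is_section s ->
    exists z : cocycle B 2, is_section_cochain s z.
  move=> sP; have [c sc] := section_cochain_exists sP.
  by exists (Cocycle (section_cocycle sc (svalP E) sP)).
have exists_cocycle (E : abext_over B) : exists z : cocycle B 2,
    exists2 s : {linear R -> sval E}, is_section s & is_section_cochain s z.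
  have [s sP] := section_exists (sval E).
  by have [z sz] := cocycle_of E s sP; exists z, s.
have [z0 z0P] := choice exists_cocycle.
(* Cohomologous cocycles differ by some d(f, m), and [dAvA1_normalize] allows m = 0, the form
   produced by a change of section. *)
have eq_pi (z z' : cocycle B 2) : \pi_(HAvA B 2) z = \pi_(HAvA B 2) z' <->
    exists f : mlin R M 1,
      cocycle_val z' = cocycle_val z + dAvA B (cochain1 f 0).
  split.
    move=> /esym/eqP; rewrite -Quotient.idealrBE => /asboolP[[f m]].
    rewrite -/(cochain1 f m) dAvA1_normalize => E.
    exists (f - delta B m); rewrite E.
    rewrite -[cocycle_val (z' - z)]/(cocycle_val z' - cocycle_val z).
    by rewrite addrC subrK.
  move=> [f z'E]; apply/esym/eqP; rewrite -Quotient.idealrBE; apply/asboolP.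
  exists (cochain1 f 0).
  rewrite -[cocycle_val (z' - z)]/(cocycle_val z' - cocycle_val z).
  by rewrite z'E addrC addKr.
exists (fun E => \pi_(HAvA B 2) (z0 E)).
split=> [E1 E2|c|E s sP].
- have [s1 s1P s1z] := z0P E1; have [s2 s2P s2z] := z0P E2.
  split=> [/eq_pi[f z2E]|iso12].
    have fl := linear_compf (linearP (ext_i (sval E1))) (mlin1_linear f).
    (* Moving [s1] by [f] gives a section of [E1] whose cochain is [z0 E2]. *)
    have sl : linear (fun r => s1 r + ext_i (sval E1) (f (vec 1 [:: r]))).
      by apply: linear_addf => //; apply: linearP.
    pose s' : {linear R -> sval E1} := pack_linear sl.
    have s'c : is_section_cochain s'
        (cocycle_val (z0 E1) + dAvA B (cochain1 f 0)).
      exact: (section_shift (s' := s') (svalP E1) s1P s1z).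
    apply: same_cochain_iso (svalP E1) (svalP E2) _ s2P s'c _.
      by move=> r; rewrite /= linearD /= ext_pi s1P addr0.
    by rewrite -z2E.
  have [s s2'P sc] := iso_section_cochain iso12 s1P s1z.
  exact/eq_pi/(sections_cohomologous (svalP E2) s2'P s2P sc s2z).
- have [E [s [EB sP sc]]] := realization (cocycleP (repr c)).
  exists (exist _ E EB).
  (* The cocycle chosen for the realized extension may differ from [repr c]; both come from sections
     of it, so their classes agree. *)
  have [s' s'P s'z] := z0P (exist _ E EB).
  rewrite -[c]reprK; apply/eq_pi.
  exact: (sections_cohomologous EB s'P sP s'z sc).
have [z sz] := cocycle_of E s sP; exists z => //.
have [s' s'P s'z] := z0P E; apply/eq_pi.
exact: (sections_cohomologous (svalP E) s'P sP s'z sz).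
Qed.
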